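(* Let $\beta_1,\beta_2,\beta_3$ and $\gamma_1,\gamma_2,\gamma_3$ be real numbers, with not all $\beta_j$ zero and not all $\gamma_j$ zero, such that $$\beta_1+\beta_2+\beta_3=0,\quad \gamma_1+\gamma_2+\gamma_3=0,\quad \beta_1\gamma_1+\beta_2\gamma_2+\beta_3\gamma_3=0.$$ Suppose $y_1,y_2,y_3:\mathbb{R}\to\mathbb{C}$ and $v:\mathbb{R}\to\mathbb{R}$ are functions of $s$, and $z_1,z_2,z_3:\mathbb{R}\to\mathbb{C}$ and $w:\mathbb{R}\to\mathbb{R}$ are functions of $t$, satisfying (i) $\frac{dy_1}{ds}=\beta_1\overline{y_2y_3}$, $\frac{dy_2}{ds}=\beta_2\overline{y_3y_1}$, $\frac{dy_3}{ds}=\beta_3\overline{y_1y_2}$; (ii) $\frac{dz_1}{dt}=\gamma_1\overline{z_2z_3}$, $\frac{dz_2}{dt}=\gamma_2\overline{z_3z_1}$, $\frac{dz_3}{dt}=\gamma_3\overline{z_1z_2}$; (iii) $|y_j|^2=\beta_jv+1$ for $j=1,2,3$; (iv) $|z_j|^2=\gamma_jw+1$ for $j=1,2,3$. If (i) and (ii) hold for all $s,t\in\mathbb{R}$ and (iii) and (iv) hold at $s=t=0$ (for some real values $v(0),w(0)$), then (iii) and (iv) hold for all $s,t$, for some functions $v,w$. Define $\Phi:\mathbb{R}^3\to\mathbb{C}^3$ by $$\Phi(r,s,t)=\tfrac{1}{\sqrt3}\bigl(r\,y_1(s)z_1(t),\,r\,y_2(s)z_2(t),\,r\,y_3(s)z_3(t)\bigr),$$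 and let $N=\{\Phi(r,s,t):r,s,t\in\mathbb{R}\}$. Then $N$ is a special Lagrangian cone in $\mathbb{C}^3$.
   Context: On $\mathbb{C}^3$ with coordinates $(z_1,z_2,z_3)$ let $g=\sum_j|dz_j|^2$, $\omega=\frac{i}{2}\sum_j dz_j\wedge d\bar z_j$ and $\Omega=dz_1\wedge dz_2\wedge dz_3$. An oriented real 3-dimensional submanifold $L$ of $\mathbb{C}^3$ is special Lagrangian if it is calibrated by $\operatorname{Re}\Omega$, i.e. $\operatorname{Re}\Omega|_{T_xL}=\mathrm{vol}_{T_xL}$ for all $x\in L$. A real 3-dimensional submanifold $L$ admits an orientation making it special Lagrangian if and only if $\omega|_L\equiv0$ and $\operatorname{Im}\Omega|_L\equiv 0$. The set $N$ may be singular (for example at $0$); ''$N$ is special Lagrangian'' means that it is special Lagrangian wherever it is nonsingular, that is, wherever $\Phi$ is an immersion: at every $(r,s,t)$ where $\frac{\partial\Phi}{\partial r},\frac{\partial\Phi}{\partial s},\frac{\partial\Phi}{\partial t}$ are linearly independent over $\mathbb{R}$, their real span is a 3-plane on which $\omega$ and $\operatorname{Im}\Omega$ vanish. A cone is a subset invariant under multiplication by positive real numbers. *)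

(* Defs.v *)
From Stdlib Require Import Reals.
From Coquelicot Require Import Coquelicot.
Open Scope R_scope.

(* Coquelicot's canonical normed-module structure on C is over C itself; here
   C^3 is needed as a normed space over R, hence the explicit structure. *)
Definition C3 : NormedModule R_AbsRing :=
  prod_NormedModule R_AbsRing
    (prod_NormedModule R_AbsRing C_R_NormedModule C_R_NormedModule)
    C_R_NormedModule.

Definition mk3 (a b c : C) : C3 := (a, b, c).
Definition pr1 (u : C3) : C := fst (fst u).
Definition pr2 (u : C3) : C := snd (fst u).
Definition pr3 (u : C3) : C := snd u.

(* (dz /\ d zbar)(u, v) = dz(u) d zbar(v) - dz(v) d zbar(u), for z a coordinate *)
Definition dz_dzbar (z : C3 -> C) (u v : C3) : C :=
  (z u * Cconj (z v) - z v * Cconj (z u))%C.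

Definition omega (u v : C3) : C :=
  (Ci / 2 * (dz_dzbar pr1 u v + dz_dzbar pr2 u v + dz_dzbar pr3 u v))%C.

(* dz1 /\ dz2 /\ dz3 evaluated on (u, v, w): the determinant of the coordinates *)
Definition Omega (u v w : C3) : C :=
  (pr1 u * (pr2 v * pr3 w - pr3 v * pr2 w)
   - pr2 u * (pr1 v * pr3 w - pr3 v * pr1 w)
   + pr3 u * (pr1 v * pr2 w - pr2 v * pr1 w))%C.

Definition lin_comb (a b c : R) (u v w : C3) : C3 :=
  plus (plus (scal a u) (scal b v)) (scal c w).

Definition lin_indep (u v w : C3) : Prop :=
  forall a b c : R, lin_comb a b c u v w = zero -> a = 0 /\ b = 0 /\ c = 0.

Definition real_span (u v w : C3) : C3 -> Prop :=
  fun x => exists a b c : R, x = lin_comb a b c u v w.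

Definition is_3plane (P : C3 -> Prop) : Prop :=
  exists u v w : C3, lin_indep u v w /\ forall x, P x <-> real_span u v w x.

Definition special_Lagrangian_plane (P : C3 -> Prop) : Prop :=
  is_3plane P
  /\ (forall u v, P u -> P v -> omega u v = 0)
  /\ (forall u v w, P u -> P v -> P w -> Im (Omega u v w) = 0).

(* The partial derivatives Fr, Fs, Ft are unique when they exist; their
   existence is part of the assertion, so that it cannot hold vacuously. *)
Definition special_Lagrangian_where_immersed (F : R -> R -> R -> C3) : Prop :=
  forall r s t : R, exists Fr Fs Ft : C3,
    is_derive (fun x : R => F x s t) r Fr
    /\ is_derive (fun x : R => F r x t) s Fs
    /\ is_derive (fun x : R => F r s x) t Ft
    /\ (lin_indep Fr Fs Ft -> special_Lagrangian_plane (real_span Fr Fs Ft)).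

Definition image3 (F : R -> R -> R -> C3) : C3 -> Prop :=
  fun p => exists r s t : R, p = F r s t.

Definition is_cone (N : C3 -> Prop) : Prop :=
  forall (c : R) (p : C3), 0 < c -> N p -> N (scal c p).

Definition has_derivC (f : R -> C) (x : R) (l : C) : Prop :=
  is_derive (K := R_AbsRing) (V := C_R_NormedModule) f x l.

Definition conj_system (b1 b2 b3 : R) (y1 y2 y3 : R -> C) : Prop :=
  forall s : R,
    has_derivC y1 s (b1 * Cconj (y2 s * y3 s))%C
    /\ has_derivC y2 s (b2 * Cconj (y3 s * y1 s))%C
    /\ has_derivC y3 s (b3 * Cconj (y1 s * y2 s))%C.

Definition moduli_at (b1 b2 b3 : R) (y1 y2 y3 : R -> C) (s v : R) : Prop :=
  Cmod (y1 s) ^ 2 = b1 * v + 1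
  /\ Cmod (y2 s) ^ 2 = b2 * v + 1
  /\ Cmod (y3 s) ^ 2 = b3 * v + 1.

Definition Phi (y1 y2 y3 z1 z2 z3 : R -> C) (r s t : R) : C3 :=
  scal (/ sqrt 3)
    (mk3 (r * y1 s * z1 t) (r * y2 s * z2 t) (r * y3 s * z3 t))%C.

(* Main.v *)
Require Import Defs.
From Stdlib Require Import Reals Lra.
From Coquelicot Require Import Coquelicot.
Open Scope R_scope.

(** Moduli.  By the equations, the derivative of [|y_j|^2] is
    [2 beta_j Re (y1 y2 y3)], with [beta_j] the only factor depending on [j].
    Hence [beta_i |y_j|^2 - beta_j |y_i|^2] is conserved, and choosing some
    [beta_k <> 0] the function [v = (|y_k|^2 - 1) / beta_k] satisfies all three
    modulus equations as soon as these hold at one point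
    ([conj_system_moduli]).

    Special Lagrangian condition.  Both forms are controlled on a real span by
    their values on the spanning vectors ([special_Lagrangian_span]), and
    [omega] is the imaginary part, up to sign, of the Hermitian product
    [herm u v = sum_j u_j conj (v_j)].  On the partial derivatives
    - [herm Phi_r Phi_s] is a multiple of [sum_j beta_j |z_j|^2], which equals
      [w sum_j beta_j gamma_j + sum_j beta_j = 0];
    - [herm Phi_r Phi_t] is a multiple of [sum_j gamma_j |y_j|^2 = 0], likewise;
    - [herm Phi_s Phi_t] is a multiple of [sum_j beta_j gamma_j = 0].
    Finally, every term of the determinant [Omega (Phi_r, Phi_s, Phi_t)] is, up
    to sign and a real factor, of the form
    [beta_j gamma_k |y_i|^2 |y_k|^2 |z_i|^2 |z_j|^2] with [i, j, k] distinct, so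
    the determinant is real.  Here the moduli equations play no role. *)

(** * Derivatives of complex-valued functions of a real variable *)

Lemma is_derive_linear {U V : NormedModule R_AbsRing} (L : U -> V)
  (f : R -> U) (x : R) (l : U) :
  is_linear L -> is_derive f x l -> is_derive (fun t => L (f t)) x (L l).
Proof.
  intros HL Hf. unfold is_derive.
  apply filterdiff_ext_lin with (fun y : R => L (scal y l)).
  - apply (filterdiff_comp' f L x (fun y : R => scal y l) L Hf).
    apply filterdiff_linear, HL.
  - intros y. apply (linear_scal L HL).
Qed.

Lemma is_derive_pair {U V : NormedModule R_AbsRing}
  (f : R -> U) (g : R -> V) (x : R) (l : U) (m : V) :
  is_derive f x l -> is_derive g x m ->
  is_derive (V := prod_NormedModule R_AbsRing U V)
    (fun t => (f t, g t)) x (l, m).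
Proof.
  intros Hf Hg. unfold is_derive.
  apply (filterdiff_comp'_2 f g (fun u v => (u, v)) x
           (fun y => scal y l) (fun y => scal y m) (fun u v => (u, v)) Hf Hg).
  apply (filterdiff_linear
           (fun t : prod_NormedModule R_AbsRing U V => (fst t, snd t))).
  apply is_linear_prod; [apply is_linear_fst | apply is_linear_snd].
Qed.

(** Multiplication by a complex constant is linear over [R], for the real
    normed structure on [C]: each component of the product is a real linear
    combination of the components of the argument. *)
Lemma is_linear_Cmult_l (c : C) :
  is_linear (U := C_R_NormedModule) (V := C_R_NormedModule)
    (fun z : C => (c * z)%C).
Proof.
  assert (Hlin : forall a b : R,
    is_linear (U := C_R_NormedModule) (V := R_NormedModule)
      (fun z : C => a * fst z + b * snd z)).
  { intros a b.
    apply (is_linear_comp (K := R_AbsRing) (U := C_R_NormedModule)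
             (V := prod_NormedModule R_AbsRing R_NormedModule R_NormedModule)
             (W := R_NormedModule)
             (fun z : C => (a * fst z, b * snd z))
             (fun p => plus (fst p) (snd p))); [|apply is_linear_plus].
    apply (is_linear_prod (T := C_R_NormedModule) (U := R_NormedModule)
             (V := R_NormedModule)).
    - apply (is_linear_comp (K := R_AbsRing) (U := C_R_NormedModule)
               (V := R_NormedModule) (W := R_NormedModule) fst (fun x : R => scal a x)).
      + apply (is_linear_fst (U := R_NormedModule) (V := R_NormedModule)).
      + apply (is_linear_scal_r (V := R_NormedModule)). exact Rmult_comm.
    - apply (is_linear_comp (K := R_AbsRing) (U := C_R_NormedModule)
               (V := R_NormedModule) (W := R_NormedModule) snd (fun x : R => scal b x)).
      + apply (is_linear_snd (U := R_NormedModule) (V := R_NormedModule)).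
      + apply (is_linear_scal_r (V := R_NormedModule)). exact Rmult_comm. }
  apply (is_linear_ext (K := R_AbsRing) (U := C_R_NormedModule) (V := C_R_NormedModule)
           (fun z : C => (fst c * fst z + - snd c * snd z,
                          snd c * fst z + fst c * snd z))).
  - intros [z1 z2]. destruct c as [c1 c2].
    apply injective_projections; simpl; ring.
  - apply (is_linear_prod (T := C_R_NormedModule) (U := R_NormedModule)
             (V := R_NormedModule));
      apply Hlin.
Qed.

Lemma has_derivC_Cmult_l (c : C) (f : R -> C) (x : R) (l : C) :
  has_derivC f x l -> has_derivC (fun t => c * f t)%C x (c * l)%C.
Proof.
  exact (is_derive_linear (U := C_R_NormedModule) (V := C_R_NormedModule)
           _ f x l (is_linear_Cmult_l c)).
Qed.

Lemma has_derivC_RtoC (x : R) : has_derivC RtoC x 1%C.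
Proof.
  apply (is_derive_pair (U := R_NormedModule) (V := R_NormedModule)
           (fun t => t) (fun _ => 0)).
  - apply (is_derive_id (K := R_AbsRing)).
  - apply (is_derive_const (K := R_AbsRing) (V := R_NormedModule)).
Qed.

Lemma is_derive_scal_mk3 (k : R) (f1 f2 f3 : R -> C) (x : R) (l1 l2 l3 : C) :
  has_derivC f1 x l1 -> has_derivC f2 x l2 -> has_derivC f3 x l3 ->
  is_derive (fun t => scal k (mk3 (f1 t) (f2 t) (f3 t))) x
    (scal k (mk3 l1 l2 l3)).
Proof.
  intros H1 H2 H3.
  apply (is_derive_linear (V := C3) (fun u : C3 => scal k u)).
  - apply (is_linear_scal_r (V := C3)). exact Rmult_comm.
  - apply (is_derive_pair
             (U := prod_NormedModule R_AbsRing C_R_NormedModule C_R_NormedModule)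
             (V := C_R_NormedModule)); [|exact H3].
    apply (is_derive_pair (U := C_R_NormedModule) (V := C_R_NormedModule));
      assumption.
Qed.

(** * Conservation laws *)

Lemma is_derive_Cmod2 (f : R -> C) (x : R) (l : C) :
  has_derivC f x l ->
  is_derive (fun t => Cmod (f t) ^ 2) x (2 * Re (Cconj (f x) * l)%C).
Proof.
  intros Hf.
  assert (Hre : is_derive (V := R_NormedModule) (fun t => Re (f t)) x (Re l)).
  { apply (is_derive_linear (U := C_R_NormedModule) (V := R_NormedModule) Re);
      [apply is_linear_fst | exact Hf]. }
  assert (Him : is_derive (V := R_NormedModule) (fun t => Im (f t)) x (Im l)).
  { apply (is_derive_linear (U := C_R_NormedModule) (V := R_NormedModule) Im);
      [apply is_linear_snd | exact Hf]. }
  apply is_derive_ext with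
    (fun t => plus (Re (f t) * Re (f t)) (Im (f t) * Im (f t))).
  { intros t. rewrite Cmod2_alt. unfold plus; simpl. ring. }
  replace (2 * Re (Cconj (f x) * l)%C)
    with (plus (Re l * Re (f x) + Re (f x) * Re l)
               (Im l * Im (f x) + Im (f x) * Im l))
    by (unfold plus, Re, Im, Cconj, Cmult; simpl; ring).
  apply (is_derive_plus (K := R_AbsRing) (V := R_NormedModule));
    apply (is_derive_mult (K := R_AbsRing));
    first [assumption | exact Rmult_comm].
Qed.

Lemma is_derive_zero_constant (f : R -> R) :
  (forall x, is_derive f x 0) -> forall x y, f x = f y.
Proof.
  intros Hf x y.
  destruct (Rtotal_order x y) as [H | [-> | H]].
  - apply (eq_is_derive f x y); [intros t _; apply Hf | exact H].
  - reflexivity.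
  - symmetry. apply (eq_is_derive f y x); [intros t _; apply Hf | exact H].
Qed.

(** If [|f|^2] and [|g|^2] have derivatives proportional, with constant
    coefficients [a] and [b], to one function [q], then
    [a |g|^2 - b |f|^2] is conserved. *)
Lemma Cmod2_conserved (a b : R) (f g df dg : R -> C) (q : R -> R) :
  (forall s, has_derivC f s (df s)) -> (forall s, has_derivC g s (dg s)) ->
  (forall s, Re (Cconj (f s) * df s)%C = a * q s) ->
  (forall s, Re (Cconj (g s) * dg s)%C = b * q s) ->
  forall s, a * Cmod (g s) ^ 2 - b * Cmod (f s) ^ 2
            = a * Cmod (g 0) ^ 2 - b * Cmod (f 0) ^ 2.
Proof.
  intros Hf Hg Ef Eg s.
  apply (is_derive_zero_constant
           (fun s => a * Cmod (g s) ^ 2 - b * Cmod (f s) ^ 2)).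
  intros x.
  replace 0 with (minus (a * (2 * Re (Cconj (g x) * dg x)%C))
                        (b * (2 * Re (Cconj (f x) * df x)%C)))
    by (rewrite Ef, Eg; unfold minus, plus, opp; simpl; ring).
  apply (is_derive_minus (K := R_AbsRing) (V := R_NormedModule));
    apply is_derive_scal, is_derive_Cmod2; auto.
Qed.

Lemma conj_system_moduli (b1 b2 b3 : R) (y1 y2 y3 : R -> C) (v0 : R) :
  ~ (b1 = 0 /\ b2 = 0 /\ b3 = 0) ->
  conj_system b1 b2 b3 y1 y2 y3 ->
  moduli_at b1 b2 b3 y1 y2 y3 0 v0 ->
  exists v : R -> R, forall s, moduli_at b1 b2 b3 y1 y2 y3 s (v s).
Proof.
  intros Hb Hy (M1 & M2 & M3).
  pose (q := fun s => Re (y1 s * y2 s * y3 s)%C).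
  assert (D1 := fun s => proj1 (Hy s)).
  assert (D2 := fun s => proj1 (proj2 (Hy s))).
  assert (D3 := fun s => proj2 (proj2 (Hy s))).
  assert (E1 : forall s, Re (Cconj (y1 s) * (b1 * Cconj (y2 s * y3 s)))%C
                         = b1 * q s)
    by (intros s; unfold q, Re, Cconj, Cmult, RtoC; simpl; ring).
  assert (E2 : forall s, Re (Cconj (y2 s) * (b2 * Cconj (y3 s * y1 s)))%C
                         = b2 * q s)
    by (intros s; unfold q, Re, Cconj, Cmult, RtoC; simpl; ring).
  assert (E3 : forall s, Re (Cconj (y3 s) * (b3 * Cconj (y1 s * y2 s)))%C
                         = b3 * q s)
    by (intros s; unfold q, Re, Cconj, Cmult, RtoC; simpl; ring).
  assert (C12 := Cmod2_conserved _ _ _ _ _ _ _ D1 D2 E1 E2).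
  assert (C13 := Cmod2_conserved _ _ _ _ _ _ _ D1 D3 E1 E3).
  assert (C23 := Cmod2_conserved _ _ _ _ _ _ _ D2 D3 E2 E3).
  rewrite M1, M2 in C12. rewrite M1, M3 in C13. rewrite M2, M3 in C23.
  (* The conservation law of the pair, solved for the second modulus. *)
  assert (solve_modulus : forall b c X Y : R, b <> 0 ->
            b * X - c * Y = b * (c * v0 + 1) - c * (b * v0 + 1) ->
            X = c * ((Y - 1) / b) + 1).
  { intros b c X Y H0 H. apply Rmult_eq_reg_l with b; [|exact H0].
    replace (b * (c * ((Y - 1) / b) + 1)) with (c * (Y - 1) + b)
      by (field; exact H0).
    lra. }
  destruct (Req_dec b1 0) as [Z1 | N1];
    [destruct (Req_dec b2 0) as [Z2 | N2];
       [destruct (Req_dec b3 0) as [Z3 | N3]; [tauto|] |] |].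
  - exists (fun s => (Cmod (y3 s) ^ 2 - 1) / b3). intros s.
    specialize (C13 s). specialize (C23 s).
    repeat split; apply solve_modulus; trivial; lra.
  - exists (fun s => (Cmod (y2 s) ^ 2 - 1) / b2). intros s.
    specialize (C12 s). specialize (C23 s).
    repeat split; apply solve_modulus; trivial; lra.
  - exists (fun s => (Cmod (y1 s) ^ 2 - 1) / b1). intros s.
    specialize (C12 s). specialize (C13 s).
    repeat split; apply solve_modulus; trivial; lra.
Qed.

(** * Special Lagrangian spans *)

(** The standard Hermitian product of [C^3], conjugate-linear on the right. *)
Definition herm (u v : C3) : C :=
  (pr1 u * Cconj (pr1 v) + pr2 u * Cconj (pr2 v) + pr3 u * Cconj (pr3 v))%C.

Lemma omega_herm (u v : C3) :
  omega u v = (Ci / 2 * (herm u v - Cconj (herm u v)))%C.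
Proof.
  unfold omega, dz_dzbar, herm.
  rewrite !Cplus_conj, !Cmult_conj, !Cconj_conj. ring.
Qed.

Lemma omega_zero_of_herm (u v : C3) : herm u v = 0 -> omega u v = 0.
Proof.
  intros H. rewrite omega_herm, H.
  apply injective_projections; simpl; ring.
Qed.

Lemma Im_zero_of_conj (c : C) : Cconj c = c -> Im c = 0.
Proof.
  intros H. assert (E := im_conj c). rewrite H in E. lra.
Qed.

Lemma pr1_lin_comb (a b c : R) (u v w : C3) :
  pr1 (lin_comb a b c u v w) = (a * pr1 u + b * pr1 v + c * pr1 w)%C.
Proof.
  destruct u as [[[] []] []], v as [[[] []] []], w as [[[] []] []].
  apply injective_projections; cbn; ring.
Qed.

Lemma pr2_lin_comb (a b c : R) (u v w : C3) :
  pr2 (lin_comb a b c u v w) = (a * pr2 u + b * pr2 v + c * pr2 w)%C.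
Proof.
  destruct u as [[[] []] []], v as [[[] []] []], w as [[[] []] []].
  apply injective_projections; cbn; ring.
Qed.

Lemma pr3_lin_comb (a b c : R) (u v w : C3) :
  pr3 (lin_comb a b c u v w) = (a * pr3 u + b * pr3 v + c * pr3 w)%C.
Proof.
  destruct u as [[[] []] []], v as [[[] []] []], w as [[[] []] []].
  apply injective_projections; cbn; ring.
Qed.

Lemma Cconj_RtoC (x : R) : Cconj (RtoC x) = RtoC x.
Proof. apply injective_projections; simpl; ring. Qed.

Lemma omega_lin_comb (u v w : C3) (a b c a' b' c' : R) :
  omega (lin_comb a b c u v w) (lin_comb a' b' c' u v w)
  = (RtoC (a * b' - b * a') * omega u v + RtoC (a * c' - c * a') * omega u w
     + RtoC (b * c' - c * b') * omega v w)%C.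
Proof.
  unfold omega, dz_dzbar.
  rewrite !pr1_lin_comb, !pr2_lin_comb, !pr3_lin_comb.
  rewrite !Cplus_conj, !Cmult_conj, !Cconj_RtoC, !RtoC_minus, !RtoC_mult.
  ring.
Qed.

Lemma Omega_lin_comb (u v w : C3) (a b c a' b' c' a'' b'' c'' : R) :
  Omega (lin_comb a b c u v w) (lin_comb a' b' c' u v w)
        (lin_comb a'' b'' c'' u v w)
  = (RtoC (a * (b' * c'' - c' * b'') - b * (a' * c'' - c' * a'')
           + c * (a' * b'' - b' * a'')) * Omega u v w)%C.
Proof.
  unfold Omega.
  rewrite !pr1_lin_comb, !pr2_lin_comb, !pr3_lin_comb.
  rewrite !RtoC_plus, !RtoC_minus, !RtoC_mult, !RtoC_minus, !RtoC_mult.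
  ring.
Qed.

Lemma special_Lagrangian_span (u v w : C3) :
  lin_indep u v w ->
  omega u v = 0 -> omega u w = 0 -> omega v w = 0 -> Im (Omega u v w) = 0 ->
  special_Lagrangian_plane (real_span u v w).
Proof.
  intros Hind Huv Huw Hvw HO. split; [|split].
  - exists u, v, w. split; [exact Hind | intros x; reflexivity].
  - intros x y (a & b & c & ->) (a' & b' & c' & ->).
    rewrite omega_lin_comb, Huv, Huw, Hvw. ring.
  - intros x y z (a & b & c & ->) (a' & b' & c' & ->) (a'' & b'' & c'' & ->).
    rewrite Omega_lin_comb, im_scal_l, HO. ring.
Qed.

(** * The partial derivatives of the parametrization *)

Lemma pr1_scal_mk3 (k : R) (a b c : C) :
  pr1 (scal k (mk3 a b c)) = (k * a)%C.
Proof.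
  apply injective_projections; cbn; ring.
Qed.

Lemma pr2_scal_mk3 (k : R) (a b c : C) :
  pr2 (scal k (mk3 a b c)) = (k * b)%C.
Proof.
  apply injective_projections; cbn; ring.
Qed.

Lemma pr3_scal_mk3 (k : R) (a b c : C) :
  pr3 (scal k (mk3 a b c)) = (k * c)%C.
Proof.
  apply injective_projections; cbn; ring.
Qed.

Lemma scal_scal_mk3 (c k : R) (a1 a2 a3 : C) :
  scal c (scal k (mk3 a1 a2 a3) : C3)
  = scal k (mk3 (c * a1) (c * a2) (c * a3))%C.
Proof.
  repeat apply injective_projections; cbn; ring.
Qed.

(** The relation [sum_j b_j |z_j|^2 = 0], for [z] with moduli governed by [g]. *)
Lemma sum_moduli_zero (b1 b2 b3 g1 g2 g3 w : R) (z1 z2 z3 : R -> C) (t : R) :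
  b1 + b2 + b3 = 0 ->
  b1 * g1 + b2 * g2 + b3 * g3 = 0 ->
  moduli_at g1 g2 g3 z1 z2 z3 t w ->
  (b1 * (z1 t * Cconj (z1 t)) + b2 * (z2 t * Cconj (z2 t))
   + b3 * (z3 t * Cconj (z3 t)))%C = 0.
Proof.
  intros Hb Hbg (M1 & M2 & M3).
  rewrite <- !Cmod2_conj, M1, M2, M3.
  rewrite <- !RtoC_mult, <- !RtoC_plus.
  f_equal.
  replace (b1 * (g1 * w + 1) + b2 * (g2 * w + 1) + b3 * (g3 * w + 1))
    with (w * (b1 * g1 + b2 * g2 + b3 * g3) + (b1 + b2 + b3)) by ring.
  rewrite Hb, Hbg. ring.
Qed.

(** The vectors below are the partial derivatives of [Phi] in [r], [s] and [t],
    for [k = 1 / sqrt 3], [y = y(s)] and [z = z(t)]. *)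
Definition dPhi_dr (k : R) (y1 y2 y3 z1 z2 z3 : C) : C3 :=
  scal k (mk3 (y1 * z1) (y2 * z2) (y3 * z3))%C.

Definition dPhi_ds (k r b1 b2 b3 : R) (y1 y2 y3 z1 z2 z3 : C) : C3 :=
  scal k (mk3 (r * z1 * (b1 * Cconj (y2 * y3)))
              (r * z2 * (b2 * Cconj (y3 * y1)))
              (r * z3 * (b3 * Cconj (y1 * y2))))%C.

Definition dPhi_dt (k r g1 g2 g3 : R) (y1 y2 y3 z1 z2 z3 : C) : C3 :=
  scal k (mk3 (r * y1 * (g1 * Cconj (z2 * z3)))
              (r * y2 * (g2 * Cconj (z3 * z1)))
              (r * y3 * (g3 * Cconj (z1 * z2))))%C.

Lemma herm_dr_ds (k r b1 b2 b3 : R) (y1 y2 y3 z1 z2 z3 : C) :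
  herm (dPhi_dr k y1 y2 y3 z1 z2 z3) (dPhi_ds k r b1 b2 b3 y1 y2 y3 z1 z2 z3)
  = (k * k * r * (y1 * y2 * y3)
     * (b1 * (z1 * Cconj z1) + b2 * (z2 * Cconj z2) + b3 * (z3 * Cconj z3)))%C.
Proof.
  unfold herm, dPhi_dr, dPhi_ds.
  rewrite !pr1_scal_mk3, !pr2_scal_mk3, !pr3_scal_mk3.
  rewrite !Cmult_conj, !Cconj_conj, !Cconj_RtoC. ring.
Qed.

Lemma herm_dr_dt (k r g1 g2 g3 : R) (y1 y2 y3 z1 z2 z3 : C) :
  herm (dPhi_dr k y1 y2 y3 z1 z2 z3) (dPhi_dt k r g1 g2 g3 y1 y2 y3 z1 z2 z3)
  = (k * k * r * (z1 * z2 * z3)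
     * (g1 * (y1 * Cconj y1) + g2 * (y2 * Cconj y2) + g3 * (y3 * Cconj y3)))%C.
Proof.
  unfold herm, dPhi_dr, dPhi_dt.
  rewrite !pr1_scal_mk3, !pr2_scal_mk3, !pr3_scal_mk3.
  rewrite !Cmult_conj, !Cconj_conj, !Cconj_RtoC. ring.
Qed.

Lemma herm_ds_dt (k r b1 b2 b3 g1 g2 g3 : R) (y1 y2 y3 z1 z2 z3 : C) :
  herm (dPhi_ds k r b1 b2 b3 y1 y2 y3 z1 z2 z3)
       (dPhi_dt k r g1 g2 g3 y1 y2 y3 z1 z2 z3)
  = (k * k * r * r * Cconj (y1 * y2 * y3) * (z1 * z2 * z3)
     * RtoC (b1 * g1 + b2 * g2 + b3 * g3))%C.
Proof.
  unfold herm, dPhi_ds, dPhi_dt.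
  rewrite !pr1_scal_mk3, !pr2_scal_mk3, !pr3_scal_mk3.
  rewrite !Cmult_conj, !Cconj_conj, !Cconj_RtoC, !RtoC_plus, !RtoC_mult. ring.
Qed.

Lemma Omega_partials_real (k r b1 b2 b3 g1 g2 g3 : R)
  (y1 y2 y3 z1 z2 z3 : C) :
  Im (Omega (dPhi_dr k y1 y2 y3 z1 z2 z3)
            (dPhi_ds k r b1 b2 b3 y1 y2 y3 z1 z2 z3)
            (dPhi_dt k r g1 g2 g3 y1 y2 y3 z1 z2 z3)) = 0.
Proof.
  apply Im_zero_of_conj.
  unfold Omega, dPhi_dr, dPhi_ds, dPhi_dt.
  rewrite !pr1_scal_mk3, !pr2_scal_mk3, !pr3_scal_mk3.
  rewrite !Cplus_conj, !Cminus_conj, !Cmult_conj, !Cminus_conj, !Cmult_conj,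
    !Cconj_conj, !Cconj_RtoC.
  ring.
Qed.

Lemma special_Lagrangian_partials (k r b1 b2 b3 g1 g2 g3 v w s t : R)
  (y1 y2 y3 z1 z2 z3 : R -> C) :
  b1 + b2 + b3 = 0 -> g1 + g2 + g3 = 0 ->
  b1 * g1 + b2 * g2 + b3 * g3 = 0 ->
  moduli_at b1 b2 b3 y1 y2 y3 s v -> moduli_at g1 g2 g3 z1 z2 z3 t w ->
  let Fr := dPhi_dr k (y1 s) (y2 s) (y3 s) (z1 t) (z2 t) (z3 t) in
  let Fs := dPhi_ds k r b1 b2 b3 (y1 s) (y2 s) (y3 s) (z1 t) (z2 t) (z3 t) in
  let Ft := dPhi_dt k r g1 g2 g3 (y1 s) (y2 s) (y3 s) (z1 t) (z2 t) (z3 t) in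
  lin_indep Fr Fs Ft -> special_Lagrangian_plane (real_span Fr Fs Ft).
Proof.
  intros Hb Hg Hbg My Mz Fr Fs Ft Hind.
  assert (Hgb : g1 * b1 + g2 * b2 + g3 * b3 = 0) by lra.
  apply special_Lagrangian_span; [exact Hind | | | |].
  - apply omega_zero_of_herm. unfold Fr, Fs.
    rewrite herm_dr_ds, (sum_moduli_zero _ _ _ _ _ _ _ _ _ _ _ Hb Hbg Mz).
    ring.
  - apply omega_zero_of_herm. unfold Fr, Ft.
    rewrite herm_dr_dt, (sum_moduli_zero _ _ _ _ _ _ _ _ _ _ _ Hg Hgb My).
    ring.
  - apply omega_zero_of_herm. unfold Fs, Ft.
    rewrite herm_ds_dt, Hbg. ring.
  - apply Omega_partials_real.
Qed.

Lemma Phi_is_cone (y1 y2 y3 z1 z2 z3 : R -> C) :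
  is_cone (image3 (Phi y1 y2 y3 z1 z2 z3)).
Proof.
  intros c p _ (r & s & t & ->).
  exists (c * r), s, t. unfold Phi.
  rewrite scal_scal_mk3, RtoC_mult, !Cmult_assoc. reflexivity.
Qed.

Lemma is_derive_Phi_r (y1 y2 y3 z1 z2 z3 : R -> C) (r s t : R) :
  is_derive (fun x => Phi y1 y2 y3 z1 z2 z3 x s t) r
    (dPhi_dr (/ sqrt 3) (y1 s) (y2 s) (y3 s) (z1 t) (z2 t) (z3 t)).
Proof.
  assert (H : forall a b : C,
            has_derivC (fun x : R => x * a * b)%C r (a * b)%C).
  { intros a b. replace (a * b)%C with (a * b * 1)%C by ring.
    apply is_derive_ext with (fun x : R => a * b * x)%C;
      [intros x; change ((a * b * x)%C = (x * a * b)%C); ring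
      | apply has_derivC_Cmult_l, has_derivC_RtoC]. }
  apply is_derive_scal_mk3; apply H.
Qed.

Lemma is_derive_Phi_s (b1 b2 b3 : R) (y1 y2 y3 z1 z2 z3 : R -> C)
  (r s t : R) :
  conj_system b1 b2 b3 y1 y2 y3 ->
  is_derive (fun x => Phi y1 y2 y3 z1 z2 z3 r x t) s
    (dPhi_ds (/ sqrt 3) r b1 b2 b3
       (y1 s) (y2 s) (y3 s) (z1 t) (z2 t) (z3 t)).
Proof.
  intros Hy. destruct (Hy s) as (H1 & H2 & H3).
  assert (H : forall (f : R -> C) (l a : C), has_derivC f s l ->
            has_derivC (fun x : R => r * f x * a)%C s (r * a * l)%C).
  { intros f l a Hf.
    apply is_derive_ext with (fun x : R => r * a * f x)%C;
      [intros x; change ((r * a * f x)%C = (r * f x * a)%C); ring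
      | apply has_derivC_Cmult_l, Hf]. }
  apply is_derive_scal_mk3; apply H; assumption.
Qed.

Lemma is_derive_Phi_t (g1 g2 g3 : R) (y1 y2 y3 z1 z2 z3 : R -> C)
  (r s t : R) :
  conj_system g1 g2 g3 z1 z2 z3 ->
  is_derive (fun x => Phi y1 y2 y3 z1 z2 z3 r s x) t
    (dPhi_dt (/ sqrt 3) r g1 g2 g3
       (y1 s) (y2 s) (y3 s) (z1 t) (z2 t) (z3 t)).
Proof.
  intros Hz. destruct (Hz t) as (H1 & H2 & H3).
  apply is_derive_scal_mk3; apply has_derivC_Cmult_l; assumption.
Qed.

Theorem theorem5p1
  (beta1 beta2 beta3 gamma1 gamma2 gamma3 : R)
  (hbeta : ~ (beta1 = 0 /\ beta2 = 0 /\ beta3 = 0))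
  (hgamma : ~ (gamma1 = 0 /\ gamma2 = 0 /\ gamma3 = 0))
  (hbeta_sum : beta1 + beta2 + beta3 = 0)
  (hgamma_sum : gamma1 + gamma2 + gamma3 = 0)
  (hbeta_gamma : beta1 * gamma1 + beta2 * gamma2 + beta3 * gamma3 = 0)
  (y1 y2 y3 z1 z2 z3 : R -> C)
  (hy : conj_system beta1 beta2 beta3 y1 y2 y3)
  (hz : conj_system gamma1 gamma2 gamma3 z1 z2 z3) :
  (forall v0 w0 : R,
     moduli_at beta1 beta2 beta3 y1 y2 y3 0 v0 ->
     moduli_at gamma1 gamma2 gamma3 z1 z2 z3 0 w0 ->
     exists v w : R -> R,
       (forall s : R, moduli_at beta1 beta2 beta3 y1 y2 y3 s (v s))
       /\ (forall t : R, moduli_at gamma1 gamma2 gamma3 z1 z2 z3 t (w t)))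
  /\
  (forall v w : R -> R,
     (forall s : R, moduli_at beta1 beta2 beta3 y1 y2 y3 s (v s)) ->
     (forall t : R, moduli_at gamma1 gamma2 gamma3 z1 z2 z3 t (w t)) ->
     is_cone (image3 (Phi y1 y2 y3 z1 z2 z3))
     /\ special_Lagrangian_where_immersed (Phi y1 y2 y3 z1 z2 z3)).
Proof.
  split.
  - intros v0 w0 My Mz.
    destruct (conj_system_moduli _ _ _ _ _ _ _ hbeta hy My) as [v Hv].
    destruct (conj_system_moduli _ _ _ _ _ _ _ hgamma hz Mz) as [w Hw].
    exists v, w. split; assumption.
  - intros v w Hv Hw. split; [apply Phi_is_cone|].
    intros r s t. do 3 eexists.
    split; [apply is_derive_Phi_r|].
    split; [apply is_derive_Phi_s, hy|].
    split; [apply is_derive_Phi_t, hz|].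
    exact (special_Lagrangian_partials _ _ _ _ _ _ _ _ _ _ _ _ _ _ _ _ _ _
             hbeta_sum hgamma_sum hbeta_gamma (Hv s) (Hw t)).
Qed.
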